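(* In the mixed model, assume that $\inf_{t\ge 0}\mu(t)>0$. Then for all $\delta>0$, all edges of the profile are of length at most $\delta$ after some almost surely finite time; i.e., almost surely there is a $t\ge 0$ such that for all $s\ge t$, $$\|x_i(s)-x_j(s)\|\le\delta\quad\text{for all}\ (i,j)\in E(s)\cap\mathscr{E}(s).$$ Therefore, asymptotic stability holds for the mixed model: almost surely, for every $i\in V$, $x_i(t)$ converges in $\mathbf{R}^d$ as $t\to\infty$.
   Context: Mixed model. $V$ is a finite set of agents, $\|\cdot\|$ is a fixed norm on $\mathbf{R}^d$, $\epsilon>0$ is the confidence threshold, and time is $t=0,1,2,\ldots$. At time $t$ agent $i$ has opinion $x_i(t)\in\mathbf{R}^d$. Given are a sequence of social graphs $G(t)=(V,E(t))$ (simple undirected graphs on $V$, possibly varying with $t$, possibly without edges) and a sequence of convergence parameters $\mu(t)\in[0,1/2]$; both sequences are deterministic. The initial opinions $x_i(0)\in\mathbf{R}^d$ are arbitrary (possibly random, independent of the selections below). At each time $t$ with $E(t)\ne\varnothing$, one edge $(i,j)\in E(t)$ is selected uniformly at random, selections at different times being independent, and $$x_i(t+1)=x_i(t)+\mu(t)(x_j(t)-x_i(t))\mathbf{1}\{\|x_i(t)-x_j(t)\|\le\epsilon\},$$ $$x_j(t+1)=x_j(t)+\mu(t)(x_i(t)-x_j(t))\mathbf{1}\{\|x_i(t)-x_j(t)\|\le\epsilon\},$$ while all other opinions are unchanged; if $E(t)=\varnothing$, no opinion changes. The opinion graph at time $t$ is $\mathscr{G}(t)=(V,\mathscr{E}(t))$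 with $\mathscr{E}(t)=\{(i,j):\|x_i(t)-x_j(t)\|\le\epsilon\}$. The profile at time $t$ is $G(t)\cap\mathscr{G}(t)$, the graph on $V$ with edge set $E(t)\cap\mathscr{E}(t)$. The length of an edge $(i,j)$ at time $t$ is $\|x_i(t)-x_j(t)\|$. *)

(* Defs.v *)
From mathcomp Require Import all_boot all_order all_algebra.
From mathcomp Require Import all_classical all_reals all_analysis.

Set Implicit Arguments.
Unset Strict Implicit.
Unset Printing Implicit Defensive.

Import Order.TTheory GRing.Theory Num.Theory.
Import numFieldNormedType.Exports.

Local Open Scope classical_set_scope.
Local Open Scope ring_scope.

(* An arbitrary norm on R^d; the canonical norm of 'rV[R]_d is the sup norm,
   which only provides the topology in which limits are taken. *)
Record is_norm (R : realType) (d : nat) (N : 'rV[R]_d -> R) : Prop := IsNorm {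
  norm_triangle : forall x y, N (x + y) <= N x + N y ;
  norm_homogeneous : forall (a : R) x, N (a *: x) = `|a| * N x ;
  norm_definite : forall x, N x = 0 -> x = 0
}.

(* The edges of a graph, as a set of unordered pairs: an undirected edge
   counts once, whereas the relation [e] contains both orientations. *)
Definition edge_set (V : finType) (e : rel V) : {set {set V}} :=
  [set [set p.1; p.2] | p : V * V & e p.1 p.2]%SET.

(* On the diagonal this relation always holds (for a norm and 0 <= eps); it is
   only used after intersection with an irreflexive social graph. *)
Definition opinion_graph (R : realType) (d : nat) (V : finType)
    (N : 'rV[R]_d -> R) (eps : R) (x : V -> 'rV[R]_d) : rel V :=
  [rel i j | N (x i - x j) <= eps].

Definition profile (R : realType) (d : nat) (V : finType)
    (N : 'rV[R]_d -> R) (eps : R) (e : rel V) (x : V -> 'rV[R]_d) : rel V :=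
  [rel i j | e i j && opinion_graph N eps x i j].

(* Mutual independence of the systems of events (F i) for i in D. *)
Definition mutually_independent (R : realType) (disp : measure_display)
    (Omega : measurableType disp) (P : probability Omega R)
    (I : eqType) (D : set I) (F : I -> set (set Omega)) : Prop :=
  forall (s : seq I) (A : I -> set Omega),
    uniq s -> (forall i, i \in s -> D i /\ F i (A i)) ->
    P (\bigcap_(i in [set` s]) A i) = (\prod_(i <- s) P (A i))%E.

(* The sigma-algebra generated by all the coordinates of (x i), i in V, i.e.
   by x regarded as a random element of (R^d)^V. *)
Definition sigma_opinions (R : realType) (d : nat) (V : finType) (Omega : Type)
    (x : V -> Omega -> 'rV[R]_d) : set (set Omega) :=
  <<s [set A | exists (i : V) (k : 'I_d) (B : set R),
         measurable B /\ A = [set w | B (x i w ord0 k)]] >>.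

(* The sigma-algebra generated by a random variable in a finite type. *)
Definition sigma_discrete (S : finType) (Omega : Type) (f : Omega -> S) :
    set (set Omega) :=
  [set A | exists B : set S, A = [set w | B (f w)]].

(* E t is the social graph, sel t the random edge selected at time t (its value
   is irrelevant when E t has no edge) and X t i the opinion of agent i at time
   t. In the independence clause the index None stands for the initial opinions
   and Some t for the selection at time t. In mixed_step, as
   [set i; j] = [set j; i], the clause updates both endpoints of the edge. *)
Record mixed_model (R : realType) (d : nat) (V : finType)
    (disp : measure_display) (Omega : measurableType disp)
    (P : probability Omega R) (N : 'rV[R]_d -> R) (eps : R)
    (E : nat -> rel V) (mu : nat -> R)
    (sel : nat -> Omega -> {set V}) (X : nat -> V -> Omega -> 'rV[R]_d) :
    Prop := MixedModel {
  mixed_sym : forall t, symmetric (E t) ;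
  mixed_irr : forall t, irreflexive (E t) ;
  mixed_mu : forall t, 0 <= mu t <= 2^-1 ;
  mixed_init_measurable : forall (i : V) (k : 'I_d),
    measurable_fun [set: Omega] (fun w => X 0%N i w ord0 k) ;
  mixed_sel_measurable : forall t (e : {set V}), (0 < #|edge_set (E t)|)%N ->
    measurable [set w | sel t w = e] ;
  mixed_sel_edge : forall t w, (0 < #|edge_set (E t)|)%N ->
    sel t w \in edge_set (E t) ;
  mixed_sel_uniform : forall t e, e \in edge_set (E t) ->
    P [set w | sel t w = e] = ((#|edge_set (E t)|%:R)^-1)%:E ;
  mixed_independent : mutually_independent P
    [set o : option nat |
       if o is Some t then (0 < #|edge_set (E t)|)%N else true]
    (fun o => if o is Some t then sigma_discrete (sel t)
              else sigma_opinions (X 0%N)) ;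
  mixed_step : forall t w i j, E t i j -> sel t w = [set i; j]%SET ->
    X t.+1 i w = X t i w +
      (mu t * (N (X t i w - X t j w) <= eps)%R%:R) *: (X t j w - X t i w) ;
  mixed_step_unselected : forall t w k, (0 < #|edge_set (E t)|)%N ->
    k \notin sel t w -> X t.+1 k w = X t k w ;
  mixed_step_no_edge : forall t w k, #|edge_set (E t)| = 0%N ->
    X t.+1 k w = X t k w
}.

(* Main.v *)
(* If [f] is convex, an interaction cannot increase the sum of [f] over the
   opinions; for the sum of the squared coordinates it even produces a decrease
   of [2 mu (1 - mu)] times the squared distance of the two opinions.

   Convergence holds along every trajectory: the squares show that the steps
   tend to 0, and convexity shows that, for every tent function, the sum over the
   agents of its values at a given coordinate converges. An oscillating
   coordinate would visit every small subinterval of some [a, b] infinitely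
   often, so that every such subinterval would eventually always contain the
   coordinate of some agent, which is impossible for more than [#|V|] disjoint
   subintervals.

   Profile edges longer than [delta]: an interaction along such an edge lowers
   the sum of squares by at least some [kappa > 0], so on the event
   [sum of squares at time 0 < M] there are at most [M / kappa] of them. The
   selection at time [t] is independent of the past and picks a given edge with
   probability at least [1 / #|{set V}|]; hence the probabilities of seeing a
   given long edge at time [t] are summable, and Borel-Cantelli applies. *)

Require Import Defs.
From mathcomp Require Import all_boot all_order all_algebra.
From mathcomp Require Import all_classical all_reals all_analysis.
From mathcomp Require Import measurable_realfun.
From mathcomp Require Import ring lra.
Import Order.TTheory GRing.Theory Num.Theory.
Import numFieldNormedType.Exports.

Set Implicit Arguments.
Unset Strict Implicit.
Unset Printing Implicit Defensive.

Local Open Scope classical_set_scope.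
Local Open Scope ring_scope.

(** * Pairwise averaging of finitely many reals *)

(** One interaction seen on a single coordinate. The value [m = 0] covers a selected pair beyond the
    confidence threshold. *)
Definition averaged (R : realType) (V : finType) (m : R) (i j : V)
    (y y' : V -> R) : Prop :=
  [/\ i != j, y' i = y i + m * (y j - y i), y' j = y j + m * (y i - y j) &
      forall k, k != i -> k != j -> y' k = y k].

(** All terms but those at [i] and [j] cancel, so monotonicity of such a sum becomes a two-point
    inequality. *)
Lemma sum_averaged (R : realType) (V : finType) (m : R) (i j : V)
    (y y' : V -> R) (f : R -> R) : averaged m i j y y' ->
  \sum_k f (y k) - \sum_k f (y' k) =
  f (y i) + f (y j) - f (y i + m * (y j - y i)) - f (y j + m * (y i - y j)).
Proof.
case=> ij yi yj yk.
rewrite (bigD1 i) //= (bigD1 j) ?[j == i]eq_sym //=.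
rewrite [X in _ - X](bigD1 i) //= [X in _ - (_ + X)](bigD1 j) ?[j == i]eq_sym //=.
rewrite yi yj (eq_bigr (fun k => f (y' k))); last by move=> k /andP[ki kj]; rewrite yk.
ring.
Qed.

(** The two new values have the same sum as the old ones and lie between them, so a convex function
    has a smaller sum there. *)
Lemma sum_hinge_averaged (R : realType) (V : finType) (m : R) (i j : V)
    (y y' : V -> R) (c : R) : 0 <= m <= 2^-1 -> averaged m i j y y' ->
  \sum_k Num.max (y' k - c) 0 <= \sum_k Num.max (y k - c) 0.
Proof.
move=> /andP[m0 m1] yy'; rewrite -subr_ge0.
rewrite (sum_averaged (fun z => Num.max (z - c) 0) yy').
set a := y i; set b := y j; clearbody a b.
(* Naming the displacement [p] and keeping only its bounds removes the product, so every sign case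
   of the hinges is linear. *)
have [p [-> -> pP]] : exists p, [/\ m * (b - a) = p, m * (a - b) = - p &
    (0 <= p <= b - a) \/ (b - a <= p <= 0)].
  exists (m * (b - a)); split; [by []|by ring|].
  have m1' : 0 <= 1 - m by lra.
  case: (leP a b) => [ab|/ltW ab]; [left|right].
    have ab' : 0 <= b - a by lra.
    by have := mulr_ge0 m1' ab'; have := mulr_ge0 m0 ab' => *; apply/andP; split; lra.
  have ab' : 0 <= a - b by lra.
  by have := mulr_ge0 m1' ab'; have := mulr_ge0 m0 ab' => *; apply/andP; split; lra.
have H z : Num.max z 0 = z /\ 0 <= z \/ Num.max z 0 = 0 /\ z <= 0 :> R.
  by case: (leP z 0) => ?; [right|left]; split => //; exact: ltW.
have [[-> ?]|[-> ?]] := H (a - c); have [[-> ?]|[-> ?]] := H (b - c);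
have [[-> ?]|[-> ?]] := H (a + p - c);
have [[-> ?]|[-> ?]] := H (b - p - c); case: pP => /andP[? ?]; lra.
Qed.

Lemma sum_square_averaged (R : realType) (V : finType) (m : R) (i j : V)
    (y y' : V -> R) : averaged m i j y y' ->
  \sum_k y k ^+ 2 - \sum_k y' k ^+ 2 = 2 * m * (1 - m) * (y i - y j) ^+ 2.
Proof. by move/(sum_averaged (fun z => z ^+ 2)) => ->; ring. Qed.

Lemma sum_square_averaged_le (R : realType) (V : finType) (m : R) (i j : V)
    (y y' : V -> R) : 0 <= m <= 2^-1 -> averaged m i j y y' ->
  \sum_k y' k ^+ 2 <= \sum_k y k ^+ 2.
Proof.
move=> /andP[m0 m1] /sum_square_averaged drop; rewrite -subr_ge0 drop.
by rewrite mulr_ge0 ?sqr_ge0//; nra.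
Qed.

(** An endpoint moves by [m * |y i - y j|], and [m <= 1/2] gives [m^2 <= 2 m (1 - m)], the factor of
    the decrease of the squares. *)
Lemma averaged_displacement (R : realType) (V : finType) (m : R) (i j : V)
    (y y' : V -> R) (k : V) : 0 <= m <= 2^-1 -> averaged m i j y y' ->
  (y' k - y k) ^+ 2 <= \sum_k y k ^+ 2 - \sum_k y' k ^+ 2.
Proof.
move=> /andP[m0 m1] yy'; rewrite (sum_square_averaged yy').
have ? : m ^+ 2 <= 2 * m * (1 - m) by nra.
case: yy' => ij yi yj yk.
have bound z : z ^+ 2 = (m * (y i - y j)) ^+ 2 ->
    z ^+ 2 <= 2 * m * (1 - m) * (y i - y j) ^+ 2.
  by move=> ->; rewrite exprMn ler_wpM2r ?sqr_ge0.
have [->|ki] := eqVneq k i; first by apply: bound; rewrite yi; ring.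
have [->|kj] := eqVneq k j; first by apply: bound; rewrite yj; ring.
by rewrite yk// subrr expr0n/= mulr_ge0 ?sqr_ge0//; nra.
Qed.

(** Discrete intermediate value property: at the first time after [t1] when [u] is at least [c], the
    preceding value is below [c] and at most [eta] away. *)
Lemma small_step_crossing (R : realType) (u : nat -> R) (c eta : R) (n : nat) :
  (forall t, (n <= t)%N -> `|u t.+1 - u t| <= eta) ->
  (exists t, (n <= t)%N /\ u t < c) ->
  (forall n, exists t, (n <= t)%N /\ c < u t) ->
  exists t, (n <= t)%N /\ `|u t - c| <= eta.
Proof.
move=> step [t1 [nt1 ut1]] /(_ t1) [t2 [t12 ut2]].
have ex : exists s, c <= u (t1 + s)%N by exists (t2 - t1)%N; rewrite subnKC// ltW.
case: (ex_minnP ex) => -[|s]; first by rewrite addn0 leNgt ut1.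
rewrite addnS => cs /(_ s) smin.
exists (t1 + s).+1; split; first by rewrite (leq_trans nt1)// -addnS leq_addr.
have us : u (t1 + s)%N < c.
  by rewrite ltNge; apply/negP => /smin; rewrite ltnn.
have := step (t1 + s)%N (leq_trans nt1 (leq_addr _ _)).
rewrite !ger0_norm; lra.
Qed.

(* A tent over [c - h, c + h] as a combination of hinges: sums of hinges are
   monotone along averaging, so sums of tents converge. *)
Definition hat (R : realType) (c h z : R) : R :=
  Num.max (z - (c - h)) 0 - 2 * Num.max (z - c) 0 + Num.max (z - (c + h)) 0.

Lemma hat_ge0 (R : realType) (c h z : R) : 0 <= h -> 0 <= hat c h z.
Proof.
move=> h0; rewrite /hat.
case: (leP (z - (c - h)) 0) => ?; case: (leP (z - c) 0) => ?;
  case: (leP (z - (c + h)) 0) => ?; lra.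
Qed.

Lemma hat_gt0 (R : realType) (c h z : R) : 0 <= h ->
  0 < hat c h z -> `|z - c| < h.
Proof.
move=> h0; rewrite ltr_norml /hat.
case: (leP (z - (c - h)) 0) => ?; case: (leP (z - c) 0) => ?;
  case: (leP (z - (c + h)) 0) => ? ?; apply/andP; split; lra.
Qed.

Lemma hat_ge (R : realType) (c h z : R) : 0 <= h -> `|z - c| <= h / 2 ->
  h / 2 <= hat c h z.
Proof.
move=> h0; rewrite ler_norml /hat => /andP[? ?].
case: (leP (z - (c - h)) 0) => ?; case: (leP (z - c) 0) => ?;
  case: (leP (z - (c + h)) 0) => ?; lra.
Qed.

Section pairwise_averaging.
Context (R : realType) (V : finType) (y : nat -> V -> R).
Context (step : forall t, y t.+1 = y t \/
  exists m i j, 0 <= m <= 2^-1 /\ averaged m i j (y t) (y t.+1)).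

Let is_cvg_sum (f : R -> R) : (forall z, 0 <= f z) ->
  (forall m i j z z', 0 <= m <= 2^-1 -> @averaged R V m i j z z' ->
    \sum_k f (z' k) <= \sum_k f (z k)) ->
  cvgn (fun t => \sum_k f (y t k)).
Proof.
move=> f0 fdec; apply: nonincreasing_is_cvgn.
  apply/nonincreasing_seqP => t.
  by have [->//|[m [i [j [mP av]]]]] := step t; exact: fdec av.
by exists 0 => _ [t _ <-]; apply: sumr_ge0.
Qed.

(** The sum of squares converges, so its successive differences tend to 0, and they dominate the
    squared displacements. *)
Let steps_vanish (i : V) (eta : R) : 0 < eta ->
  exists n, forall t, (n <= t)%N -> `|y t.+1 i - y t i| <= eta.
Proof.
move=> eta0.
have cW : cvgn (fun t => \sum_k y t k ^+ 2).
  by apply: (@is_cvg_sum (fun z => z ^+ 2)) => [z|]; [exact: sqr_ge0|exact: sum_square_averaged_le].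
have : (fun t => \sum_k y t k ^+ 2 - \sum_k y t.+1 k ^+ 2) @ \oo --> (0 : R).
  have cS : (fun t => \sum_k y t.+1 k ^+ 2) @ \oo --> limn (fun t => \sum_k y t k ^+ 2).
    by rewrite (cvg_shiftS (fun t => \sum_k y t k ^+ 2)).
  by have cWS := cvgB cW cS; rewrite subrr in cWS; apply: cWS.
move=> /cvgr0Pnorm_le /(_ _ (exprn_gt0 2 eta0)) [n _ nP].
exists n => t /nP /= le_eta.
have : (y t.+1 i - y t i) ^+ 2 <= eta ^+ 2.
  apply: le_trans (le_trans (ler_norm _) le_eta).
  have [->|[m [i' [j [mP av]]]]] := step t; first by rewrite !subrr expr0n.
  exact: averaged_displacement av.
by rewrite -(real_normK (num_real (_ - _))) ler_sqr ?nnegrE// ltW.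
Qed.

(** The sum of the tents centred at [c] converges. It is at least [h / 2] whenever agent [i] is
    within [h / 2] of [c], and it is 0 when no agent is within [h]; so the latter eventually stops
    happening. *)
Let recurrent_occupied (i : V) (c h : R) : 0 < h ->
  (forall n, exists t, (n <= t)%N /\ `|y t i - c| <= h / 2) ->
  exists n, forall t, (n <= t)%N -> exists j, `|y t j - c| < h.
Proof.
move=> h0 rec.
have chinge c' : cvgn (fun t => \sum_k Num.max (y t k - c') 0).
  apply: (@is_cvg_sum (fun z => Num.max (z - c') 0)).
    by move=> z; rewrite le_max lexx orbT.
  by move=> m i' j z z'; exact: sum_hinge_averaged.
have chat : cvgn (fun t => \sum_k hat c h (y t k)).
  rewrite (_ : (fun t => _) = (fun t => \sum_k Num.max (y t k - (c - h)) 0)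
      - (fun t => 2 * \sum_k Num.max (y t k - c) 0)
      + (fun t => \sum_k Num.max (y t k - (c + h)) 0)).
    by apply: is_cvgD => //; apply: is_cvgB => //; apply: is_cvgMr.
  by apply/funext => t; rewrite !fctE /hat big_split/= sumrB -mulr_sumr.
have hat0 z : 0 <= hat c h z by apply: hat_ge0; exact: ltW.
(* With tolerance [h / 4] around the limit, two late sums differ by less than [h / 2], which
   excludes one being 0 and the other at least [h / 2]. *)
have h20 : 0 < h / 2 / 2 by rewrite !divr_gt0.
move/cvgrPdist_lt: chat => /(_ _ h20) [n _ nP].
have [s [ns si]] := rec n.
exists n => t nt; apply: contrapT => /forallNP noj.
have sum0 : \sum_k hat c h (y t k) = 0.
  apply: big1 => k _; apply/eqP; rewrite eq_le hat0 andbT leNgt; apply/negP.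
  by move/(hat_gt0 (ltW h0)); exact: noj.
have : h / 2 <= \sum_k hat c h (y s k).
  rewrite (bigD1 i)//=; apply: ler_wpDr; first by apply: sumr_ge0.
  by apply: hat_ge => //; exact: ltW.
have := nP _ ns; have := nP _ nt; rewrite /= sum0 !ltr_norml => /andP[? ?] /andP[? ?]; lra.
Qed.

(* Otherwise [#|V|.+1] disjoint intervals inside [a, b] would each contain some
   [y t j] at a common time [t]. *)
Let no_oscillation (i : V) (a b : R) : a < b ->
  (forall n, exists t, (n <= t)%N /\ y t i < a) ->
  (forall n, exists t, (n <= t)%N /\ b < y t i) -> False.
Proof.
move=> ab la lb.
(* [[a, b]] is cut into [#|V|.+1] cells of width [2 * h] with centres [c k]. *)
pose h := (b - a) / (2 * #|V|.+1%:R).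
have h0 : 0 < h by rewrite divr_gt0 ?subr_gt0// mulr_gt0.
pose c (k : nat) := a + (2 * k%:R + 1) * h.
have cP (k : 'I_#|V|.+1) : a < c k < b.
  apply/andP; split.
    by rewrite /c ltrDl mulr_gt0// ltr_wpDl// mulr_ge0.
  have -> : b = a + 2 * #|V|.+1%:R * h.
    rewrite /h mulrCA mulfV ?mulr1 ?mulf_neq0 ?pnatr_eq0//; ring.
  rewrite /c ltrD2l ltr_pM2r//.
  have : (k.+1%:R <= #|V|.+1%:R :> R) by rewrite ler_nat.
  by rewrite -natr1; lra.
have occ (k : 'I_#|V|.+1) : exists n, forall t, (n <= t)%N -> exists j, `|y t j - c k| < h.
  apply: (@recurrent_occupied i) => // n0.
  have [n1 n1P] := @steps_vanish i (h / 2) (divr_gt0 h0 (ltr0Sn _ _)).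
  have /andP[ac cb] := cP k.
  (* Once the steps are at most [h / 2], agent [i] cannot jump over the middle half of a cell, so it
     returns there forever. *)
  have [|||t [nt tP]] := @small_step_crossing R (fun t => y t i) (c k) (h / 2) (maxn n0 n1).
  - by move=> t; rewrite geq_max => /andP[_]; exact: n1P.
  - have [t [nt yta]] := la (maxn n0 n1).
    by exists t; split => //; exact: lt_trans ac.
  - move=> n; have [t [nt bt]] := lb n.
    by exists t; split => //; exact: lt_trans bt.
  by exists t; move: nt; rewrite geq_max => /andP[].
have /choice [n nP] := occ.
pose t := \max_k n k.
have /choice [f fP] : forall k : 'I_#|V|.+1, exists j, `|y t j - c k| < h.
  by move=> k; apply: nP; exact: leq_bigmax.
(* Pigeonhole: an agent within [h] of two centres forces them to be less than [2 * h] apart, hence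
   equal. *)
have finj : injective f.
  move=> k l fkl; have := fP k; have := fP l; rewrite fkl !ltr_norml.
  move=> /andP[? ?] /andP[? ?].
  have close (p q : nat) : c p - c q < 2 * h -> (p <= q)%N.
    rewrite /c; move=> H; rewrite leqNgt; apply/negP => qp.
    have : (q.+1%:R <= p%:R :> R) by rewrite ler_nat.
    by rewrite -natr1; nra.
  by apply: val_inj; apply/eqP; rewrite eqn_leq !close//; lra.
by have := leq_card f finj; rewrite card_ord ltnn.
Qed.

Lemma pairwise_averaging_cvg (i : V) : cvgn (fun t => y t i).
Proof.
(* The added 1 gives [M <= M^2], so the bound [M] on the square also bounds the absolute value. *)
pose M := 1 + \sum_k y 0%N k ^+ 2.
have yM t : `|y t i| <= M.
  have M1 : 1 <= M by rewrite lerDl sumr_ge0// => k _; exact: sqr_ge0.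
  have H : y t i ^+ 2 <= M.
    suff : \sum_k y t k ^+ 2 <= M.
      by apply: le_trans; rewrite (bigD1 i)//= lerDl sumr_ge0// => k _; exact: sqr_ge0.
    elim: t => [|t]; first by rewrite lerDr.
    by apply: le_trans; have [->//|[m [i' [j [mP]]]]] := step t; exact: sum_square_averaged_le.
  by rewrite ler_norml; apply/andP; split; nra.
(* [sup A] is the limit inferior of [y t i]. Exceeding [sup A + e] infinitely often would make the
   coordinate oscillate across [[sup A + e / 2, sup A + e]]. *)
pose A := [set c | exists n, forall t, (n <= t)%N -> c <= y t i].
have A0 : A !=set0 by exists (- M), 0%N => t _; have := yM t; rewrite ler_norml => /andP[].
have Aub : has_ubound A.
  exists M => c [n /(_ n (leqnn n))] /le_trans; apply.
  exact: le_trans (ler_norm _) (yM n).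
apply/cvg_ex; exists (sup A); apply/cvgrPdist_le => e e0.
have [c [n nP] cA] := @sup_adherent _ A e e0 (conj A0 Aub).
have [n' n'P] : exists n', forall t, (n' <= t)%N -> y t i <= sup A + e.
  apply: contrapT => /forallNP nb.
  apply: (@no_oscillation i (sup A + e / 2) (sup A + e)); first by lra.
    move=> p; apply: contrapT => /forallNP np.
    have : sup A + e / 2 <= sup A.
      apply: ub_le_sup => //; exists p => t pt.
      by rewrite leNgt; apply/negP => ?; exact: (np t).
    by lra.
  move=> p; have /existsNP[t /not_implyP[pt /negP]] := nb p.
  by rewrite -ltNge; exists t.
exists (maxn n n') => // t /=; rewrite geq_max => /andP[nt n't].
have := nP t nt; have := n'P t n't; rewrite ler_norml => ? ?; apply/andP; split; lra.
Qed.

End pairwise_averaging.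

(** * Measurability *)

(** Expansion in the canonical basis: one half of the equivalence of norms. Adding 1 to the constant
    keeps it positive even for [d = 0]. *)
Lemma is_norm_le_sum (R : realType) (d : nat) (N : 'rV[R]_d -> R) :
  is_norm N ->
  exists2 C : R, 0 < C & forall z, N z <= C * \sum_k `|z ord0 k|.
Proof.
case=> tri hom _.
have N0 : N 0 = 0 by rewrite -(scale0r 0) hom normr0 mul0r.
have NN z : N (- z) = N z by rewrite -scaleN1r hom normrN1 mul1r.
have Nge0 z : 0 <= N z by have := tri z (- z); rewrite subrr N0 NN; lra.
exists (1 + \sum_k N (delta_mx 0 k)).
  by rewrite ltr_pwDl ?sumr_ge0.
move=> z; rewrite {1}[z]row_sum_delta mulr_sumr.
elim/big_ind2: _ => [|x a y b xa yb|k _]; first by rewrite N0.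
  exact: le_trans (tri _ _) (lerD xa yb).
rewrite hom mulrC ler_wpM2r// (bigD1 k)//= addrCA lerDl addr_ge0//.
exact: sumr_ge0.
Qed.

Lemma is_norm_gt_sum_square (R : realType) (d : nat) (N : 'rV[R]_d -> R)
    (delta : R) : is_norm N -> 0 < delta ->
  exists2 kappa : R, 0 < kappa &
    forall z, delta < N z -> kappa <= \sum_k z ord0 k ^+ 2.
Proof.
move=> /is_norm_le_sum[C C0 NC] delta0.
(* If all coordinates are at most [r] in absolute value, then [N z <= C * d * r <= delta]; [d.+1]
   avoids a division by 0. *)
pose r := delta / (C * d.+1%:R).
have r0 : 0 < r by rewrite divr_gt0// mulr_gt0.
exists (r ^+ 2); first exact: exprn_gt0.
move=> z; rewrite leNgt; apply: contraL => small; rewrite -leNgt.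
have zr k : `|z ord0 k| <= r.
  rewrite -ler_sqr ?nnegrE ?normr_ge0 ?(ltW r0)// real_normK ?num_real// ltW//.
  by apply: le_lt_trans small; rewrite (bigD1 k)//= lerDl sumr_ge0// => ? _; exact: sqr_ge0.
apply: le_trans (NC z) _; rewrite -ler_pdivlMl// mulrC.
apply: le_trans (ler_sum _ (fun k _ => zr k)) _.
rewrite sumr_const card_ord -mulr_natr.
have -> : delta / C = r * d.+1%:R.
  by rewrite /r invfM !mulrA mulrVK ?unitfE ?pnatr_eq0.
by rewrite ler_wpM2l ?(ltW r0)// ler_nat.
Qed.

Lemma measurable_set_ltr (R : realType) (disp : measure_display)
    (T : measurableType disp) (f : T -> R) (c : R) :
  measurable_fun [set: T] f -> measurable [set w | f w < c].
Proof.
move=> mf; rewrite (_ : [set w | _] = [set: T] `&` f @^-1` `]-oo, c[).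
  exact: mf.
by rewrite setTI; apply/seteqP; split => w /=; rewrite in_itv.
Qed.

(* [N z < c] is witnessed by a rational vector [q] near [z] with [N q < c]. *)
Lemma measurable_is_norm (R : realType) (d : nat) (N : 'rV[R]_d -> R)
    (disp : measure_display) (T : measurableType disp) (u : T -> 'rV[R]_d) :
  is_norm N -> (forall k, measurable_fun [set: T] (fun w => u w ord0 k)) ->
  measurable_fun [set: T] (fun w => N (u w)).
Proof.
move=> hN mu; have [C C0 NC] := is_norm_le_sum hN.
have tri := norm_triangle hN.
have NN z : N (- z) = N z.
  by rewrite -scaleN1r (norm_homogeneous hN) normrN1 mul1r.
have near (z q : 'rV[R]_d) r : (forall k, `|z ord0 k - q ord0 k| < r) ->
    N z <= N q + C * (d%:R * r) /\ N q <= N z + C * (d%:R * r).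
  move=> zq; have H : N (z - q) <= C * (d%:R * r).
    apply: le_trans (NC _) _; rewrite ler_pM2l//.
    apply: le_trans (_ : _ <= \sum_(k < d) r) _.
      by apply: ler_sum => k _; rewrite !mxE ltW.
    by rewrite sumr_const card_ord mulr_natl.
  split; first by have := tri (z - q) q; rewrite subrK; lra.
  have := tri (q - z) z; rewrite subrK -[q - z]opprB NN; lra.
move=> mT; apply: (measurability _ (RGenInftyO.measurableE R)) => //.
move=> _ [_ [c ->] <-]; rewrite setTI.
pose rad (n : nat) : R := n.+1%:R^-1.
pose q' (q : 'rV[rat]_d) : 'rV[R]_d := map_mx ratr q.
rewrite (_ : _ @^-1` _ = \bigcup_n \bigcup_q
    ([set w | N (q' q) + C * (d%:R * rad n) < c] `&`
     \bigcap_k [set w | `|u w ord0 k - q' q ord0 k| < rad n])).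
  apply: bigcupT_measurable => n; apply: countable_bigcupT_measurable => [|q].
    exact: countableP.
  apply: measurableI.
    case: (ltP (N (q' q) + C * (d%:R * rad n)) c) => _.
      by rewrite (_ : [set _ | _] = setT)//; apply/seteqP; split.
    by rewrite (_ : [set _ | _] = set0)//; apply/seteqP; split.
  apply: fin_bigcap_measurable => // k _; apply: measurable_set_ltr.
  by apply: measurableT_comp => //; apply: measurable_funB.
apply/seteqP; split => w /=; rewrite in_itv/=.
  move=> Nwc.
  have rad0 n : 0 < rad n by rewrite /rad invr_gt0.
  (* The factor 2 pays once for passing from [u w] to [q] and once for the margin demanded of
     [N q]. *)
  have [n nP] : exists n, 2 * (C * (d%:R * rad n)) < c - N (u w).
    have cN : 0 < c - N (u w) by lra.
    have K0 : 0 < 2 * C * d%:R + 1 by rewrite ltr_wpDl// mulr_ge0// mulr_ge0// ltW.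
    have [n] := ltr_add_invr (divr_gt0 cN K0).
    rewrite add0r ltr_pdivlMr// => nP; exists n.
    apply: le_lt_trans nP; have := rad0 n; rewrite -/(rad n).
    by move: (rad n) (d%:R : R) => r D r0; lra.
  have /choice[f fP] k : exists q : rat, `|u w ord0 k - ratr q| < rad n.
    have [|q] := @rat_in_itvoo R (u w ord0 k - rad n) (u w ord0 k + rad n).
      by have := rad0 n; lra.
    rewrite in_itv/= => /andP[? ?]; exists q; rewrite ltr_norml; apply/andP; split; lra.
  exists n => //; exists (\row_k f k) => //; split => /=.
    have [|_] := near (u w) (q' (\row_k f k)) (rad n); last by lra.
    by move=> k; rewrite !mxE.
  by move=> k _ /=; rewrite !mxE.
case=> n _ [q _ [/= qc uq]].
by have [|] := near (u w) (q' q) (rad n); [move=> k; exact: uq|lra].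
Qed.

(** Generators of the product sigma-algebra on [(R^d)^V], in the same form as in [sigma_opinions],
    so that events on the initial configuration pull back into it. *)
Definition opinion_cylinders (R : realType) (d : nat) (V : finType) :
    set (set (V -> 'rV[R]_d)) :=
  [set A | exists (i : V) (k : 'I_d) (B : set R),
     measurable B /\ A = [set x : V -> 'rV[R]_d | B (x i ord0 k)]].

Notation configuration R d V :=
  (g_sigma_algebraType (@opinion_cylinders R d V)).

Lemma measurable_opinion (R : realType) (d : nat) (V : finType) (i : V)
    (k : 'I_d) :
  measurable_fun [set: configuration R d V] (fun x => x i ord0 k).
Proof.
by move=> _ B mB; rewrite setTI; apply: sub_sigma_algebra; exists i, k, B.
Qed.

Lemma measurable_fun_opinions (R : realType) (d : nat) (V : finType)
    (disp : measure_display) (T : measurableType disp)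
    (Y : T -> configuration R d V) :
  (forall i k, measurable_fun [set: T] (fun w => Y w i ord0 k)) ->
  measurable_fun [set: T] Y.
Proof.
move=> mY mT; apply: (@measurability _ _ T (configuration R d V) setT Y
  (@opinion_cylinders R d V) erefl) => //.
by move=> _ [_ [i [k [B [mB ->]]]] <-]; exact: mY.
Qed.

Lemma measurable_opinion_distance (R : realType) (d : nat) (V : finType)
    (N : 'rV[R]_d -> R) (i j : V) : is_norm N ->
  measurable_fun [set: configuration R d V] (fun x => N (x i - x j)).
Proof.
move=> hN; apply: (measurable_is_norm hN) => k.
rewrite (_ : (fun _ => _) = (fun x : configuration R d V => x i ord0 k - x j ord0 k)).
  by apply: measurable_funB; exact: measurable_opinion.
by apply/funext => x; rewrite !mxE.
Qed.

(** The deterministic update once the edge is known. The second branch tests [x j - x i], which is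
    what [mixed_step] gives for the reversed edge. *)
Definition interact (R : realType) (d : nat) (V : finType) (N : 'rV[R]_d -> R)
    (eps m : R) (i j : V) (x : V -> 'rV[R]_d) : V -> 'rV[R]_d :=
  fun k => if k == i then
      x i + (m * (N (x i - x j) <= eps)%R%:R) *: (x j - x i)
    else if k == j then
      x j + (m * (N (x j - x i) <= eps)%R%:R) *: (x i - x j)
    else x k.

Lemma measurable_interact (R : realType) (d : nat) (V : finType)
    (N : 'rV[R]_d -> R) (eps m : R) (i j : V) : is_norm N ->
  measurable_fun [set: configuration R d V]
    (interact N eps m i j : configuration R d V -> configuration R d V).
Proof.
move=> hN; apply: measurable_fun_opinions => k c; rewrite /interact.
have mstep (a b : V) : measurable_fun [set: configuration R d V]
    (fun x => (x a + (m * (N (x a - x b) <= eps)%R%:R) *: (x b - x a)) ord0 c).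
  rewrite (_ : (fun _ => _) = (fun x : configuration R d V =>
      x a ord0 c + (m * (N (x a - x b) <= eps)%R%:R) * (x b ord0 c - x a ord0 c))).
    apply: measurable_funD; first exact: measurable_opinion.
    apply: measurable_funM; last by apply: measurable_funB; exact: measurable_opinion.
    apply: measurable_funM => //.
    rewrite (_ : (fun _ => _) = (fun x : configuration R d V =>
      if (N (x a - x b) <= eps)%R then 1 else 0)).
      apply: measurable_fun_ifT => //.
      by apply: measurable_fun_ler => //; exact: measurable_opinion_distance.
    by apply/funext => x; case: ifP.
  by apply/funext => x; rewrite !mxE.
have [_|_] := eqVneq k i; first exact: mstep.
by have [_|_] := eqVneq k j; [exact: mstep|exact: measurable_opinion].
Qed.

(** * Selections are independent of the past *)

Section mixed_model_dynamics.
Context (R : realType) (d : nat) (V : finType) (disp : measure_display)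
  (Omega : measurableType disp) (P : probability Omega R) (N : 'rV[R]_d -> R)
  (eps : R) (E : nat -> rel V) (mu : nat -> R) (sel : nat -> Omega -> {set V})
  (X : nat -> V -> Omega -> 'rV[R]_d).
Context (hN : is_norm N) (hX : mixed_model P N eps E mu sel X).

Let opinions (t : nat) (w : Omega) : configuration R d V := fun i => X t i w.

Lemma mem_edge_set (e : rel V) (i j : V) : e i j -> [set i; j]%SET \in edge_set e.
Proof. by move=> eij; apply/imsetP; exists (i, j); rewrite ?inE. Qed.

Lemma mixed_interact (t : nat) (w : Omega) (i j : V) :
  E t i j -> sel t w = [set i; j]%SET ->
  opinions t.+1 w = interact N eps (mu t) i j (opinions t w).
Proof.
move=> Eij selij; apply/funext => k; rewrite /opinions /interact.
have [->|ki] := eqVneq k i; first exact: (mixed_step hX Eij selij).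
have [->|kj] := eqVneq k j.
  apply: (mixed_step hX); first by rewrite (mixed_sym hX).
  by rewrite selij finset.setUC.
apply: (mixed_step_unselected hX).
  by apply/card_gt0P; exists [set i; j]%SET; exact: mem_edge_set.
by rewrite selij !inE (negbTE ki) (negbTE kj).
Qed.

Lemma mixed_no_edge (t : nat) (w : Omega) :
  ~~ (0 < #|edge_set (E t)|)%N -> opinions t.+1 w = opinions t w.
Proof.
rewrite -eqn0Ngt => /eqP E0; apply/funext => k.
exact: (mixed_step_no_edge hX).
Qed.

(** Randomness enters a step only through the selected edge. A set that is not an edge is never
    selected, so the identity can serve as its update. *)
Lemma mixed_transition (t : nat) : (0 < #|edge_set (E t)|)%N ->
  exists Phi : {set V} -> configuration R d V -> configuration R d V,
    (forall f, measurable_fun [set: configuration R d V] (Phi f)) /\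
    forall w, opinions t.+1 w = Phi (sel t w) (opinions t w).
Proof.
move=> E0.
have /choice[Phi PhiP] : forall f, exists phi : configuration R d V -> configuration R d V,
    measurable_fun [set: configuration R d V] phi /\
    forall w, sel t w = f -> opinions t.+1 w = phi (opinions t w).
  move=> f; have [/imsetP[[i j]] /=|fE] := boolP (f \in edge_set (E t)).
    rewrite inE => Eij ->; exists (interact N eps (mu t) i j); split.
      exact: measurable_interact.
    by move=> w; exact: mixed_interact.
  exists id; split => // w selw.
  by move: fE; rewrite -selw (mixed_sel_edge hX).
exists Phi; split => [f|w]; first by have [] := PhiP f.
by have [_] := PhiP (sel t w); exact.
Qed.

Let selected (t : nat) (f : {set V}) : set Omega := [set w | sel t w = f].

Lemma mixed_measurable_opinions (t : nat) : measurable_fun [set: Omega] (opinions t).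
Proof.
elim: t => [|t IH].
  by apply: measurable_fun_opinions => i k; exact: mixed_init_measurable hX i k.
have [E0|E0] := boolP (0 < #|edge_set (E t)|)%N; last first.
  by rewrite (_ : opinions t.+1 = opinions t)//; apply/funext => w; exact: mixed_no_edge.
have [Phi [mPhi PhiP]] := mixed_transition E0.
move=> _ D mD; rewrite setTI.
rewrite (_ : _ @^-1` D = \bigcup_(f in [set: {set V}])
    (selected t f `&` (Phi f \o opinions t) @^-1` D)).
  apply: fin_bigcup_measurable; first exact: finite_finset.
  move=> f _; apply: measurableI; first exact: (mixed_sel_measurable hX).
  rewrite -[X in measurable X]setTI.
  by apply: measurableT_comp.
apply/seteqP; split => w /=.
  by rewrite PhiP => Dw; exists (sel t w).
by case=> f _ [/= <-]; rewrite PhiP.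
Qed.

Lemma sum_selected (t : nat) (A : set Omega) : (0 < #|edge_set (E t)|)%N ->
  measurable A -> P A = (\sum_(f \in [set: {set V}]) P (A `&` selected t f))%E.
Proof.
move=> E0 mA.
have defA : A = \bigcup_(f in [set: {set V}]) (A `&` selected t f).
  apply/seteqP; split => w; first by move=> Aw; exists (sel t w).
  by case=> f _ [].
rewrite {1}defA; apply: measure_fin_bigcup; first exact: finite_finset.
  by move=> f g _ _ [w [[_ <-] [_ <-]]].
by move=> f _; apply: measurableI => //; exact: (mixed_sel_measurable hX).
Qed.

Lemma sigma_opinions_preimage (D : set (configuration R d V)) :
  measurable D -> sigma_opinions (X 0%N) (opinions 0%N @^-1` D).
Proof.
move=> mD; rewrite /sigma_opinions; set G := (G in <<s G>>).
have m0 : measurable_fun [set: g_sigma_algebraType G]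
    (opinions 0%N : g_sigma_algebraType G -> configuration R d V).
  apply: measurable_fun_opinions => i k _ B mB; rewrite setTI.
  by apply: sub_sigma_algebra; exists i, k, B.
by have := m0 measurableT _ mD; rewrite setTI.
Qed.

Lemma independent_selections (D0 : set (configuration R d V)) (t : nat)
    (D : set (configuration R d V)) (s : seq nat) (e : nat -> {set V}) :
  measurable D0 -> measurable D -> uniq s ->
  (forall r, r \in s -> (t <= r)%N /\ (0 < #|edge_set (E r)|)%N) ->
  P (opinions 0%N @^-1` D0 `&` opinions t @^-1` D `&`
     \bigcap_(r in [set` s]) selected r (e r)) =
  (P (opinions 0%N @^-1` D0 `&` opinions t @^-1` D) *
   \prod_(r <- s) P (selected r (e r)))%E.
Proof.
move=> mD0; elim: t => [|t IH] in D s e * => mD us sE.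
  rewrite -preimage_setI.
  have mDD : measurable (D0 `&` D) by exact: measurableI.
  (* At time 0 both configuration events concern the initial opinions and merge into the single
     event of index [None]. *)
  pose A (o : option nat) := if o is Some r then selected r (e r)
    else opinions 0%N @^-1` (D0 `&` D).
  have := @mixed_independent _ _ _ _ _ _ _ _ _ _ _ _ hX (None :: map Some s) A.
  rewrite big_cons big_map /=; move=> <-.
  - congr (P _); apply/seteqP; split => w /=.
      by move=> [D0Dw sw] [r|] //=; rewrite inE/= (mem_map Some_inj); exact: sw.
    move=> Aw; split; first exact: (Aw None).
    by move=> r rs; apply: (Aw (Some r)); rewrite /= inE/= (mem_map Some_inj).
  - rewrite (map_inj_uniq Some_inj) us andbT.
    by apply/mapP => -[].
  - move=> [r|]; rewrite inE/=.
      rewrite (mem_map Some_inj).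
      by move=> /sE[_ Er]; split => //; exists [set e r].
    by move=> _; split => //; exact: sigma_opinions_preimage.
have [E0|E0] := boolP (0 < #|edge_set (E t)|)%N; last first.
  rewrite (_ : opinions t.+1 = opinions t); last by apply/funext => w; exact: mixed_no_edge.
  by apply: IH => // r /sE[/ltnW].
have [Phi [mPhi PhiP]] := mixed_transition E0.
have mO t' D' : measurable D' -> measurable (opinions t' @^-1` D').
  by move=> mD'; rewrite -[X in measurable X]setTI; exact: mixed_measurable_opinions.
have mS (s' : seq nat) : (forall r, r \in s' -> (0 < #|edge_set (E r)|)%N) ->
    measurable (\bigcap_(r in [set` s']) selected r (e r)).
  move=> s'E; apply: bigcap_measurableType => r /s'E.
  exact: (mixed_sel_measurable hX).
(* Stated for any list because it is used twice: for [s], and for the empty list, where it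
   identifies the sum over [f] as the probability of the configuration events alone. *)
have split_selected (s' : seq nat) : uniq s' ->
    (forall r, r \in s' -> (t < r)%N /\ (0 < #|edge_set (E r)|)%N) ->
  P (opinions 0%N @^-1` D0 `&` opinions t.+1 @^-1` D `&`
     \bigcap_(r in [set` s']) selected r (e r)) =
  ((\sum_(f \in [set: {set V}])
     P (opinions 0%N @^-1` D0 `&` opinions t @^-1` (Phi f @^-1` D)) * P (selected t f)) *
   \prod_(r <- s') P (selected r (e r)))%E.
  move=> us' s'E; rewrite (sum_selected E0); last first.
    apply: measurableI; last by apply: mS => r /s'E[].
    by apply: measurableI; exact: mO.
  rewrite ge0_mule_fsuml; last by move=> f; rewrite mule_ge0.
  apply: eq_fsbigr => f _.
  pose e' r := if r == t then f else e r.
  have ts' : t \notin s' by apply/negP => /s'E[]; rewrite ltnn.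
  have e'E r : r \in s' -> e' r = e r.
    by rewrite /e'; case: eqVneq => // -> ts; rewrite ts in ts'.
  transitivity (P (opinions 0%N @^-1` D0 `&` opinions t @^-1` (Phi f @^-1` D) `&`
      \bigcap_(r in [set` t :: s']) selected r (e' r))).
    congr (P _); apply/seteqP; split => w /=.
      move=> [[[D0w Dw] sw] tw]; split; first by split => //; rewrite -tw -PhiP.
      move=> r /=; rewrite inE => /predU1P[->|rs]; first by rewrite /e' eqxx.
      by rewrite e'E//; exact: sw.
    move=> [[D0w Dw] sw].
    have tw : sel t w = f by have := sw t; rewrite /= mem_head /e' eqxx; exact.
    split => //; split; first by split => //; rewrite PhiP tw.
    by move=> r rs; rewrite -e'E//; apply: sw; rewrite /= inE rs orbT.
  rewrite IH.
  - rewrite big_cons muleA {1}/e' eqxx; congr (_ * _)%E.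
    by rewrite !big_seq; apply: eq_bigr => r rs; rewrite e'E.
  - by rewrite -[X in measurable X]setTI; exact: mPhi.
  - by rewrite /= ts'.
  - by move=> r; rewrite inE => /predU1P[->//|/s'E[/ltnW]].
rewrite split_selected//; congr (_ * _)%E.
have := split_selected [::] erefl.
by rewrite big_nil mule1 set_nil bigcap_set0 setIT => -> // r; rewrite in_nil.
Qed.

Lemma selected_independent (D0 D : set (configuration R d V)) (t : nat)
    (f : {set V}) : measurable D0 -> measurable D -> f \in edge_set (E t) ->
  P (opinions 0%N @^-1` D0 `&` opinions t @^-1` D `&` selected t f) =
  (P (opinions 0%N @^-1` D0 `&` opinions t @^-1` D) *
   ((#|edge_set (E t)|%:R)^-1)%:E)%E.
Proof.
move=> mD0 mD ft.
have := @independent_selections D0 t D [:: t] (fun=> f) mD0 mD erefl.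
rewrite big_seq1 (mixed_sel_uniform hX ft) => <-.
  congr (P _); congr (_ `&` _); apply/seteqP; split => w /=.
    by move=> selw r; rewrite /= inE => /eqP ->.
  by apply; rewrite /= inE.
by move=> r; rewrite inE => /eqP ->; split => //; apply/card_gt0P; exists f.
Qed.

End mixed_model_dynamics.

(** * Energy and asymptotic stability *)

(** The sum of the probabilities is the expected number of events that occur, a number bounded by
    [c] pointwise. *)
Lemma sum_measure_le_overlap (R : realType) (disp : measure_display)
    (Omega : measurableType disp) (P : probability Omega R)
    (L : nat -> set Omega) (c : R) (n : nat) :
  (forall t, measurable (L t)) ->
  (forall w, \sum_(t < n) \1_(L t) w <= c) ->
  (\sum_(t < n) P (L t) <= c%:E)%E.
Proof.
move=> mL Lc.
rewrite (eq_bigr (fun t : 'I_n => \int[P]_w (\1_(L t) w)%:E)%E); last first.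
  by move=> t _; rewrite integral_indic// setIT.
rewrite -ge0_integral_sum//; last first.
  by move=> t; apply/measurable_EFinP; exact: measurable_indic.
rewrite -[leRHS]mule1 -(@probability_setT _ _ _ P) -integral_cst//.
apply: ge0_le_integral => //.
- by move=> w _; apply: sume_ge0 => t _; rewrite lee_fin.
- apply: emeasurable_sum => t; apply/measurable_EFinP; exact: measurable_indic.
- by move=> w _; rewrite sumEFin lee_fin.
Qed.

Section mixed_model_stability.
Context (R : realType) (d : nat) (V : finType) (disp : measure_display)
  (Omega : measurableType disp) (P : probability Omega R) (N : 'rV[R]_d -> R)
  (eps : R) (E : nat -> rel V) (mu : nat -> R) (sel : nat -> Omega -> {set V})
  (X : nat -> V -> Omega -> 'rV[R]_d).
Context (hN : is_norm N) (hX : mixed_model P N eps E mu sel X).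

Let opinions (t : nat) (w : Omega) : configuration R d V := fun i => X t i w.

Lemma mixed_averaged (t : nat) (w : Omega) (i j : V) (c : 'I_d) :
  E t i j -> sel t w = [set i; j]%SET ->
  averaged (mu t * (N (X t i w - X t j w) <= eps)%R%:R) i j
    (fun k => X t k w ord0 c) (fun k => X t.+1 k w ord0 c).
Proof.
move=> Eij selij.
have ij : i != j by apply: contraTneq Eij => ->; rewrite (mixed_irr hX).
(* By symmetry of the norm both endpoints pass or fail the same threshold test, so one parameter
   serves for both. *)
have NC : N (X t j w - X t i w) = N (X t i w - X t j w).
  by rewrite -opprB -scaleN1r (norm_homogeneous hN) normrN1 mul1r.
have XS k : X t.+1 k w = interact N eps (mu t) i j (opinions t w) k.
  by rewrite -(mixed_interact hX Eij selij).
split => //; rewrite ?XS /interact /opinions ?eqxx.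
- by rewrite !mxE.
- by rewrite eq_sym (negbTE ij) NC !mxE.
- by move=> k ki kj; rewrite XS /interact (negbTE ki) (negbTE kj).
Qed.

Lemma mixed_coordinate_step (c : 'I_d) (w : Omega) (t : nat) :
  (fun k => X t.+1 k w ord0 c) = (fun k => X t k w ord0 c) \/
  exists m i j, 0 <= m <= 2^-1 /\
    averaged m i j (fun k => X t k w ord0 c) (fun k => X t.+1 k w ord0 c).
Proof.
have [E0|E0] := boolP (0 < #|edge_set (E t)|)%N; last first.
  left; apply/funext => k.
  by have /(congr1 (@^~ k)) /= -> := mixed_no_edge hX w E0.
right; have /imsetP[[i j]] := mixed_sel_edge hX w E0.
rewrite inE /= => Eij selij.
exists (mu t * (N (X t i w - X t j w) <= eps)%R%:R), i, j; split.
  have := mixed_mu hX t; case: (_ <= eps); first by rewrite mulr1.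
  by rewrite mulr0 lexx invr_ge0 ler0n.
exact: mixed_averaged.
Qed.

(** Each coordinate evolves by pairwise averaging, so it converges for every outcome; there are
    finitely many coordinates, and the topology is that of the sup norm. *)
Lemma mixed_opinion_cvg (w : Omega) (i : V) :
  exists l : 'rV[R]_d, (fun t => X t i w) @ \oo --> l.
Proof.
have cX (c : 'I_d) : cvgn (fun t => X t i w ord0 c).
  exact: (@pairwise_averaging_cvg R V (fun t k => X t k w ord0 c)
    (mixed_coordinate_step c w)).
exists (\row_c limn (fun t => X t i w ord0 c)).
apply/cvgrPdist_lt => e e0.
have /choice[n nP] (c : 'I_d) : exists n, forall t, (n <= t)%N ->
    `|limn (fun t => X t i w ord0 c) - X t i w ord0 c| < e.
  by have /cvgrPdist_lt/(_ _ e0)[n _ nP] := cX c; exists n.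
exists (\max_c n c)%N => // t /= nt.
rewrite [`|_|]mx_normrE; apply/bigmax_ltP; split => // -[a c] _ /=.
rewrite [a]ord1 !mxE; apply: nP; apply: leq_trans nt; exact: leq_bigmax.
Qed.

(** Coordinates are summed outermost, so the scalar results on squares apply to each inner sum. *)
Let energy (x : V -> 'rV[R]_d) : R := \sum_c \sum_k x k ord0 c ^+ 2.

Lemma energy_ge0 (x : V -> 'rV[R]_d) : 0 <= energy x.
Proof. by apply: sumr_ge0 => c _; apply: sumr_ge0 => k _; exact: sqr_ge0. Qed.

Lemma energy_nonincreasing (w : Omega) (t : nat) :
  energy (opinions t.+1 w) <= energy (opinions t w).
Proof.
apply: ler_sum => c _; rewrite /opinions.
have [XS|[m [i [j [mP av]]]]] := mixed_coordinate_step c w t.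
  by apply: ler_sum => k _; have := congr1 (@^~ k) XS; rewrite /= => ->.
exact: sum_square_averaged_le av.
Qed.

(** From [mu t <= 1/2] follows [2 mu (1 - mu) >= mu >= inf mu], and a difference of norm above
    [delta] has its sum of squares bounded below; the resulting [kappa] is uniform in time, outcome
    and edge. *)
Lemma energy_drop (delta : R) : 0 < delta -> 0 < inf (range mu) ->
  exists2 kappa : R, 0 < kappa & forall t w i j,
    E t i j -> sel t w = [set i; j]%SET ->
    delta < N (X t i w - X t j w) <= eps ->
    kappa <= energy (opinions t w) - energy (opinions t.+1 w).
Proof.
move=> delta0 hmu; have [kappa kappa0 kappaP] := is_norm_gt_sum_square hN delta0.
exists (inf (range mu) * kappa); first exact: mulr_gt0.
move=> t w i j Eij selij /andP[dN Ne].
have inf_le : inf (range mu) <= mu t.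
  apply: ge_inf; last by exists t.
  by exists 0 => _ [s _ <-]; have /andP[] := mixed_mu hX s.
have /andP[mu0 mu1] := mixed_mu hX t.
rewrite -sumrB (eq_bigr (fun c => 2 * mu t * (1 - mu t) *
    (X t i w - X t j w) ord0 c ^+ 2)); last first.
  move=> c _; have := mixed_averaged c Eij selij; rewrite Ne mulr1.
  by move/sum_square_averaged => ->; rewrite !mxE.
rewrite -mulr_sumr.
have := kappaP _ dN; set S := \sum_(_ < _) _ => kS.
apply: ler_pM => //; [exact: ltW|exact: ltW|].
by nra.
Qed.

Lemma long_edge_finitely_often (delta : R) (i j : V) :
  0 < delta -> 0 < inf (range mu) ->
  {ae P, forall w, exists t : nat, forall s, (t <= s)%N ->
    ~ (E s i j /\ delta < N (X s i w - X s j w) <= eps)}.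
Proof.
move=> delta0 hmu; have [kappa kappa0 kappaP] := energy_drop delta0 hmu.
(* The initial energy may be unbounded and not integrable; restricting to [A M] bounds the count of
   long interactions, and the countably many [M] cover all outcomes. *)
pose A (M : nat) : set (configuration R d V) := [set x | energy x < M%:R].
pose D (t : nat) : set (configuration R d V) :=
  [set x | E t i j /\ delta < N (x i - x j) <= eps].
have mA M : measurable (A M).
  apply: measurable_set_ltr; apply: measurable_sum => c; apply: measurable_sum => k.
  by apply: measurable_funX; exact: measurable_opinion.
have mD t : measurable (D t).
  have mdist := @measurable_opinion_distance R d V N i j hN.
  have mlong : measurable_fun [set: configuration R d V]
      (fun x => delta < N (x i - x j) <= eps).
    by apply: measurable_and; [exact: measurable_fun_ltr|exact: measurable_fun_ler].
  have [Eij|Eij] := boolP (E t i j); last first.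
    by rewrite (_ : D t = set0)//; apply/seteqP; split => // x [/(negP Eij)].
  rewrite (_ : D t = [set: configuration R d V] `&`
      (fun x => delta < N (x i - x j) <= eps) @^-1` [set true]); first exact: mlong.
  by rewrite setTI; apply/seteqP; split => x /= => [[]|].
have mO t D' : measurable D' -> measurable (opinions t @^-1` D').
  move=> mD'; rewrite -[X in measurable X]setTI.
  exact: (mixed_measurable_opinions hN hX).
(* [B M t] depends only on configurations up to time [t]; [L M t] below also requires that the long
   edge be selected. *)
pose B M t := opinions 0%N @^-1` A M `&` opinions t @^-1` D t.
have mB M t : measurable (B M t) by apply: measurableI; exact: mO.
pose L M t := B M t `&` [set w | sel t w = [set i; j]%SET].
have edges t : E t i j -> (0 < #|edge_set (E t)|)%N.
  by move=> Eij; apply/card_gt0P; exists [set i; j]%SET; exact: mem_edge_set.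
have noE M t : ~~ E t i j -> B M t = set0.
  by move=> Eij; apply/seteqP; split => // w [_ [/(negP Eij)]].
have mL M t : measurable (L M t).
  have [Eij|Eij] := boolP (E t i j); last by rewrite /L noE// set0I.
  by apply: measurableI => //; apply: (mixed_sel_measurable hX); exact: edges.
have overlap M n w : \sum_(t < n) \1_(L M t) w <= M%:R / kappa.
  have [w0|w0] := pselect (A M (opinions 0%N w)); last first.
    rewrite big1 ?divr_ge0 ?(ltW kappa0)// => t _.
    by rewrite indicE memNset// => -[[]].
  rewrite ler_pdivlMr//.
  suff : (\sum_(t < n) \1_(L M t) w) * kappa <=
      energy (opinions 0%N w) - energy (opinions n w).
    by move/le_trans; apply; have := energy_ge0 (opinions n w); move: w0; rewrite /A /=; lra.
  elim: n => [|n IH]; first by rewrite big_ord0 mul0r subrr.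
  rewrite big_ord_recr/= mulrDl.
  have : \1_(L M n) w * kappa <= energy (opinions n w) - energy (opinions n.+1 w).
    rewrite indicE; case: (boolP (w \in L M n)) => [|_].
      by rewrite inE mul1r => -[[_ [Eij dN]] selij]; exact: kappaP selij dN.
    by rewrite mul0r subr_ge0 energy_nonincreasing.
  lra.
(* Edges are subsets of [V], so [K] bounds their number at every time, and a given edge is selected
   with probability at least [1 / K]. *)
pose K : R := #|{set V}|%:R.
have BL M t : (P (B M t) <= K%:E * P (L M t))%E.
  have [Eij|Eij] := boolP (E t i j); last by rewrite noE// measure0 mule_ge0// lee_fin.
  have Pfin : P (B M t) \is a fin_num by exact: fin_num_measure.
  rewrite /L (selected_independent hN hX (mA M) (mD t) (mem_edge_set Eij)).
  rewrite -/(B M t) -(fineK Pfin) -!EFinM lee_fin mulrCA ler_peMr ?fine_ge0//.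
  by rewrite ler_pdivlMr ?ltr0n ?edges// mul1r ler_nat max_card.
(* Borel-Cantelli: the partial sums of [P (B M t)] are at most [K] times [M / kappa]. *)
have lim0 M : P (lim_sup_set (B M)) = 0%E.
  apply: lim_sup_set_cvg0 => //.
  apply: (@le_lt_trans _ _ (K * (M%:R / kappa))%:E); last by rewrite ltry.
  apply: lime_le; first by apply: is_cvg_nneseries.
  apply: nearW => n; rewrite big_mkord.
  apply: (@le_trans _ _ (\sum_(t < n) K%:E * P (L M t))%E).
    by apply: lee_sum => t _; exact: BL.
  rewrite -ge0_sume_distrr// EFinM lee_pmul2l// ?lte_fin ?ltr0n.
    exact: sum_measure_le_overlap.
  by apply/card_gt0P; exists finset.set0.
have : P.-negligible (\bigcup_M lim_sup_set (B M)).
  apply: negligible_bigcup => M; apply/negligibleP; last exact: lim0.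
  apply: bigcap_measurableType => n _; exact: bigcup_measurable.
apply: negligibleS => w /= H.
have [M wM] : exists M : nat, energy (opinions 0%N w) < M%:R.
  exists (Num.truncn (energy (opinions 0%N w))).+1.
  exact: truncnS_gt.
exists M => // n _; apply: contrapT => noB; apply: H; exists n => s ns [Eij dN].
by apply: noB; exists s.
Qed.

End mixed_model_stability.

(** * Short profile edges and convergence of the opinions *)

Unset Implicit Arguments.

Theorem corollary3 (R : realType) (d : nat) (V : finType)
    (disp : measure_display) (Omega : measurableType disp)
    (P : probability Omega R) (N : 'rV[R]_d -> R) (eps : R)
    (E : nat -> rel V) (mu : nat -> R)
    (sel : nat -> Omega -> {set V}) (X : nat -> V -> Omega -> 'rV[R]_d)
    (hN : is_norm N) (heps : 0 < eps)
    (hX : mixed_model P N eps E mu sel X)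
    (hmu : 0 < inf (range mu)) :
  (forall delta : R, 0 < delta ->
     {ae P, forall w, exists t : nat, forall s : nat, (t <= s)%N ->
        forall i j : V, profile N eps (E s) (fun k => X s k w) i j ->
          N (X s i w - X s j w) <= delta}) /\
  {ae P, forall w, forall i : V,
     exists l : 'rV[R]_d, (fun t => X t i w) @ \oo --> l}.
Proof.
split; last by apply: aeW => w i; exact: (mixed_opinion_cvg hN hX).
move=> delta delta0.
(* There are finitely many pairs, so their null sets can be united and the maximum of their last
   times taken. *)
have : {ae P, forall w, forall p : V * V, exists t : nat, forall s, (t <= s)%N ->
    ~ (E s p.1 p.2 /\ delta < N (X s p.1 w - X s p.2 w) <= eps)}.
  apply: filter_forall => -[i j]; exact: (long_edge_finitely_often hN hX).
apply: filterS => w /choice[t tP].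
exists (\max_p t p)%N => s ts i j /andP[Eij Nij].
rewrite leNgt; apply/negP => dN; apply: (tP (i, j) s); last by rewrite dN.
by apply: leq_trans ts; exact: leq_bigmax.
Qed.
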